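(* Let $A_n(\rho)$ be an $n\times n$ complex matrix whose entries are analytic functions of $\rho$ in a region containing $\rho_c\in\mathbb{C}$. Suppose $A_n(\rho_c)$ has an eigenvalue $\lambda_c\ne 0$ of algebraic multiplicity $2$, and that the two eigenvalues $\lambda(\rho)$ of $A_n(\rho)$ that coalesce to $\lambda_c$ at $\rho=\rho_c$ are given by a convergent Puiseux series $$\lambda(\rho)=\lambda_c\left[1\pm a\epsilon^{1/2}+b\epsilon+O\left(\epsilon^{3/2}\right)\right],\quad \epsilon=\rho-\rho_c\to 0,$$ with $a,b\in\mathbb{C}$, $a\neq 0$. Write $a=|a|e^{i\theta_a}$, $b=|b|e^{i\theta_b}$, $\Theta=\theta_b-2\theta_a$. Let $\rho=\rho_c+d\exp(-i2\theta_a)$ with $d\in\mathbb{R}$. Then as $d\to 0$, $$\mathrm{Re}\left\{\frac{\lambda(\rho)}{\lambda_c}\right\}=\begin{cases}1-|d||b|\cos\Theta+O\left(|d|^{3/2}\right),& d\le 0,\\ 1\pm|a|\sqrt d+d|b|\cos\Theta+O\left(d^{3/2}\right),& d\ge 0;\end{cases}$$ $$\mathrm{Im}\left\{\frac{\lambda(\rho)}{\lambda_c}\right\}=\begin{cases}\pm|a|\sqrt{|d|}-|d||b|\sin\Theta+O\left(|d|^{3/2}\right),& d\le 0,\\ d|b|\sin\Theta+O\left(d^{3/2}\right),& d\ge 0;\end{cases}$$ $$\left|\frac{\lambda(\rho)}{\lambda_c}\right|=\begin{cases}1+|d|\,\frac12\left(|a|^2-2|b|\cos\Theta\right)+O\left(|d|^{3/2}\right),&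 d\le 0,\\ 1\pm|a|\sqrt d+d|b|\cos\Theta+O\left(d^{3/2}\right),& d\ge 0.\end{cases}$$
   Context: The $\pm$ sign corresponds to the two eigenvalues $\lambda(\rho)$ near $\lambda_c$ (upper signs for one eigenvalue, lower signs for the other). The values of the multivalued arguments $\theta_a,\theta_b$ may be chosen arbitrarily. *)

(* Defs.v *)
From HB Require Import structures.
From mathcomp Require Import all_boot all_order all_algebra complex.
From mathcomp Require Import all_classical all_reals all_analysis.
Import Order.TTheory GRing.Theory Num.Theory.
Import numFieldNormedType.Exports.

Set Implicit Arguments.
Unset Strict Implicit.
Unset Printing Implicit Defensive.

Local Open Scope classical_set_scope.
Local Open Scope ring_scope.
Local Open Scope complex_scope.

(* The regular algebra [R[i]^o] is the copy of [R[i]] that carries the topology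
   induced by the modulus. *)
Notation Cplx R := (complex R)^o.

Definition cmod (R : realType) (z : Cplx R) : R := ComplexField.Normc.normc z.

Definition cis (R : realType) (t : R) : Cplx R := cos t +i* sin t.

Definition cpseries (R : realType) (c : nat -> Cplx R) (z : Cplx R) :
  nat -> Cplx R := series (fun k => c k * z ^+ k).

Definition analytic_at (R : realType) (f : Cplx R -> Cplx R) (z0 : Cplx R) :=
  exists c : nat -> Cplx R,
    \forall z \near z0, cpseries c (z - z0) @ \oo --> f z.

(* [l1] and [l2] are pointwise selections of the two eigenvalues (with
   multiplicity) of [A rho] that tend to [lc]; no regularity of the labelling
   is assumed, since the two branches may be exchanged around [rc]. *)
Definition coalescing_eigenvalues (R : realType) (n : nat)
    (A : Cplx R -> 'M[Cplx R]_n) (rc lc : Cplx R) (l1 l2 : Cplx R -> Cplx R) :=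
  [/\ \forall rho \near rc,
        ('X - (l1 rho)%:P) * ('X - (l2 rho)%:P) %| char_poly (A rho),
      l1 rho @[rho --> rc] --> lc
    & l2 rho @[rho --> rc] --> lc].

(* The values at [rc + eps] are [lc * \sum_k c_k (+- s) ^ k], where [s] is
   either square root of [eps]: the pair is unordered, so no branch of the
   square root has to be chosen. *)
Definition puiseux_pair (R : realType) (rc lc : Cplx R)
    (l1 l2 : Cplx R -> Cplx R) (c : nat -> Cplx R) :=
  \forall s \near (0 : Cplx R),
    [/\ cvgn (cpseries c s), cvgn (cpseries c (- s))
      & perm_eq [:: l1 (rc + s ^+ 2); l2 (rc + s ^+ 2)]
          [:: lc * limn (cpseries c s); lc * limn (cpseries c (- s))]].

(* Main.v *)
(** Substituting a square root of [d * exp (- 2 i ta)] for [s] in the Puiseux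
    series turns [1 + a s + b s ^ 2] into [1 +- |a| sqrt d + d |b| exp (i Theta)],
    where [sqrt d] is real or purely imaginary according to the sign of [d]; the
    tail of the series is [O(|s| ^ 3)] because its coefficients are dominated by
    a geometric sequence.  The modulus follows from the real and imaginary
    parts: with [Q] the claimed quadratic in [t = sqrt |d|], the terms of
    [|z| ^ 2 - Q ^ 2] of degree at most 2 in [t] cancel, and
    [||z| - Q| <= 2 ||z| ^ 2 - Q ^ 2|] as soon as [1/2 <= Q]. *)

Require Import Defs.
From HB Require Import structures.
From mathcomp Require Import all_boot all_order all_algebra complex.
From mathcomp Require Import all_classical all_reals all_analysis.
From mathcomp Require Import ring lra.
Import Order.TTheory GRing.Theory Num.Theory.
Import numFieldNormedType.Exports.

Local Open Scope classical_set_scope.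
Local Open Scope ring_scope.
Local Open Scope complex_scope.

(** * Tails of convergent power series *)

(** Convergence at [z0] bounds the terms [c k * z0 ^+ k]. When [z] is at most half as large as [z0],
    the tail at [z] is dominated by a geometric series of ratio 1/2, whose sum is twice its first
    term. *)
Lemma power_series_remainder (K : numFieldType) (c : nat -> K^o) (z0 : K^o)
    (n : nat) :
  z0 != 0 -> cvgn (series (fun k => c k * z0 ^+ k)) ->
  exists2 M : K, 0 <= M & forall z l : K^o, 2 * `|z| <= `|z0| ->
    series (fun k => c k * z ^+ k) @ \oo --> l ->
    `|l - series (fun k => c k * z ^+ k) n| <= M * `|z| ^+ n.
Proof.
move=> z0_neq0 /cvg_series_cvg_0 /cvgP /cvg_seq_bounded /pinfty_ex_gt0[M M0 hM].
have nz0 : 0 < `|z0| by rewrite normr_gt0.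
exists (2 * M / `|z0| ^+ n).
  by rewrite divr_ge0 ?exprn_ge0 ?mulr_ge0 // ltW.
move=> z l hz hl.
set u := series _ in hl *.
pose r := `|z| / `|z0|.
have r0 : 0 <= r by rewrite divr_ge0.
have r2 : r <= 2^-1 by rewrite ler_pdivrMr // mulrC ler_pdivlMr // mulrC.
have term j : `|c (n + j)%N * z ^+ (n + j)| <= M * r ^+ n * 2^-1 ^+ j.
  have -> : `|c (n + j)%N * z ^+ (n + j)| =
      `|c (n + j)%N * z0 ^+ (n + j)| * (r ^+ n * r ^+ j).
    rewrite -exprD !normrM !normrX expr_div_n -mulrA; congr (_ * _).
    by rewrite mulrCA divff ?mulr1 // expf_neq0 // gt_eqF.
  rewrite -mulrA; apply: ler_pM => //.
  - by rewrite mulr_ge0 ?exprn_ge0.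
  - exact: hM.
  - by rewrite ler_wpM2l ?exprn_ge0 // lerXn2r // nnegrE // invr_ge0.
(* The exact geometric sum, rather than its bound 2, is what makes the induction on [j] close. *)
have partial j :
    `|u (n + j)%N - u n| <= M * r ^+ n * (2 - 2 * 2^-1 ^+ j).
  elim: j => [|j IH]; first by rewrite addn0 subrr normr0 expr0 mulr1 subrr mulr0.
  have -> : u (n + j.+1)%N - u n =
      (u (n + j)%N - u n) + c (n + j)%N * z ^+ (n + j).
    by rewrite addnS /u seriesSr addrAC.
  apply: le_trans (ler_normD _ _) _; apply: le_trans (lerD IH (term j)) _.
  rewrite -mulrDr le_eqVlt; apply/orP; left; apply/eqP; congr (_ * _).
  by rewrite exprS; field.
apply/ler_addgt0Pr => e e0.
have /cvgrPdist_lt/(_ e e0)[N _ hN] := hl.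
have {}hN := hN (n + N)%N (leq_addl _ _).
rewrite (_ : l - u n = (u (n + N)%N - u n) + (l - u (n + N)%N)); last first.
  by rewrite [RHS]addrC addrA subrK.
apply: le_trans (ler_normD _ _) _; apply: lerD (ltW hN).
apply: le_trans (partial N) _.
have -> : 2 * M / `|z0| ^+ n * `|z| ^+ n = M * r ^+ n * 2.
  by rewrite expr_div_n; ring.
rewrite ler_wpM2l ?mulr_ge0 ?exprn_ge0 ?(ltW M0) //.
by rewrite gerBl mulr_ge0 // exprn_ge0 // invr_ge0.
Qed.

(** * Landau bounds on half-lines, real and imaginary parts, moduli *)

Lemma powR_3div2 (R : realType) (x : R) :
  0 <= x -> x `^ (3 / 2) = Num.sqrt x ^+ 3.
Proof.
by move=> x0; rewrite mulrC powRrM powR12_sqrt // powR_mulrn // sqrtr_ge0.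
Qed.

Lemma bigO_within0 (R : realType) (D : set R) (f g h : R -> R) (K e : R) :
  let F := within D (nbhs (0 : R)) in
  0 < e ->
  (forall d, D d -> `|d| < e -> `|f d - g d| <= K * `|h d|) ->
  f = g +O_F h.
Proof.
move=> F e0 hfg; apply/eqaddOP; apply/eqOP; apply/eqO_exP.
(* The sign of [K] is not known, and the witness has to be positive. *)
exists (`|K| + 1); first by rewrite ltr_wpDl.
rewrite near_withinE; apply/nbhs_normP; exists e => //= d.
rewrite /ball_ /= sub0r normrN => hd Dd.
apply: le_trans (hfg d Dd hd) _; rewrite ler_wpM2r //.
by rewrite (le_trans (ler_norm K)) // lerDl.
Qed.

Lemma norm_cmod (R : realType) (z : Cplx R) : `|z| = (cmod z)%:C.
Proof. by []. Qed.

Lemma normr_Re_le (R : realType) (z : Cplx R) : `|complex.Re z| <= cmod z.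
Proof.
case: z => x y; rewrite /cmod /= -sqrtr_sqr.
by rewrite ler_wsqrtr // lerDl sqr_ge0.
Qed.

Lemma normr_Im_le (R : realType) (z : Cplx R) : `|complex.Im z| <= cmod z.
Proof.
case: z => x y; rewrite /cmod /= -sqrtr_sqr.
by rewrite ler_wsqrtr // lerDr sqr_ge0.
Qed.

Lemma cisD (R : realType) (s t : R) : cis (s + t) = cis s * cis t.
Proof. by rewrite /cis cosD sinD /=; simpc; rewrite [sin s * _ + _]addrC. Qed.

Lemma cis0 (R : realType) : cis (0 : R) = 1.
Proof. by rewrite /cis cos0 sin0. Qed.

Lemma cmod_cis (R : realType) (t : R) : cmod (cis t) = 1.
Proof. by rewrite /cmod /= cos2Dsin2 sqrtr1. Qed.

Lemma cmodE (R : realType) (z : Cplx R) :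
  cmod z = Num.sqrt (complex.Re z ^+ 2 + complex.Im z ^+ 2).
Proof. by case: z. Qed.

(** Radii of neighbourhoods in [R[i]] are themselves complex. The order compares only numbers with
    equal imaginary parts, so a positive radius is real. *)
Lemma gtc0_realE (R : realType) (r : R[i]) :
  0 < r -> r = (complex.Re r)%:C /\ 0 < complex.Re r.
Proof. by case: r => x y; rewrite ltcE /= => /andP[/eqP ->]. Qed.

(** * From real and imaginary parts to the modulus *)

Lemma ler_norm_quadratic (R : realType) (x y z t : R) :
  0 <= t <= 1 -> `|x + y * t + z * t ^+ 2| <= `|x| + `|y| + `|z|.
Proof.
move=> /andP[t0 t1].
apply: le_trans (ler_normD _ _) _; apply: lerD.
  apply: le_trans (ler_normD _ _) _; rewrite lerD2l normrM [`|t|]ger0_norm //.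
  by rewrite ler_piMr.
by rewrite normrM [`|t ^+ 2|]ger0_norm ?exprn_ge0 // ler_piMr // exprn_ile1.
Qed.

(** The coefficient [p + v ^+ 2 / 2] is forced by degree 2: the sum of squares contributes
    [u ^+ 2 + 2 * p + v ^+ 2] there, the square of the quadratic [u ^+ 2 + 2 * P]. *)
Lemma modulus_expansion (R : realType) (u v p q K : R) : 0 <= K ->
  exists C e : R, 0 < e /\ forall t x y : R, 0 <= t -> t < e ->
    `|x - (1 + u * t + p * t ^+ 2)| <= K * t ^+ 3 ->
    `|y - (v * t + q * t ^+ 2)| <= K * t ^+ 3 ->
    `|Num.sqrt (x ^+ 2 + y ^+ 2)
      - (1 + u * t + (p + v ^+ 2 / 2) * t ^+ 2)| <= C * t ^+ 3.
Proof.
move=> K0; pose P := p + v ^+ 2 / 2.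
(* For [t <= 1], [A] and [B] bound the two approximating polynomials [X] and [Y]; [D] collects the
   coefficients of degrees 3 and 4 in [X ^+ 2 + Y ^+ 2 - Q ^+ 2]. *)
pose A : R := 1 + `|u| + `|p|; pose B : R := `|v| + `|q|.
pose D : R :=
  `|2 * u * p + 2 * v * q - 2 * u * P| + `|p ^+ 2 + q ^+ 2 - P ^+ 2|.
pose C := K * (K + 2 * A) + K * (K + 2 * B) + D.
have S0 : 0 < 2 * (1 + `|u| + `|P|) by rewrite mulr_gt0 // addr_gt0_ge0 // ltr_wpDr.
(* This threshold gives both [t <= 1] and [Q >= 1/2]; the factor 2 pays for the division by
   [m + Q >= 1/2]. *)
exists (2 * C), (2 * (1 + `|u| + `|P|))^-1; split; first by rewrite invr_gt0.
move=> t x y t0 te hx hy; rewrite -/P.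
have tS : t * (2 * (1 + `|u| + `|P|)) < 1 by rewrite -ltr_pdivlMr // mul1r.
have t1 : t <= 1.
  move: tS (normr_ge0 u) (normr_ge0 P); nra.
have t01 : 0 <= t <= 1 by rewrite t0 t1.
have t3 : 0 <= t ^+ 3 by rewrite exprn_ge0.
have t31 : t ^+ 3 <= 1 by rewrite exprn_ile1.
set X := 1 + u * t + p * t ^+ 2 in hx *.
set Y := v * t + q * t ^+ 2 in hy *.
set Q := 1 + u * t + P * t ^+ 2.
set m := Num.sqrt _.
have XA : `|X| <= A by rewrite (le_trans (ler_norm_quadratic _ _ _ _ _ t01)) // normr1.
have YB : `|Y| <= B.
  rewrite /Y -[v * t]add0r.
  by rewrite (le_trans (ler_norm_quadratic _ _ _ _ _ t01)) // normr0 add0r.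
have Q2 : 2^-1 <= Q.
  have : - (`|u| * t) <= u * t.
    by rewrite -[in X in - X](ger0_norm t0) -normrM lerNnormlW.
  have : - (`|P| * t ^+ 2) <= P * t ^+ 2.
    by rewrite -[in X in - X](@ger0_norm _ (t ^+ 2)) ?exprn_ge0 // -normrM lerNnormlW.
  rewrite /Q; move: tS (normr_ge0 u) (normr_ge0 P); nra.
have m0 : 0 <= m by rewrite sqrtr_ge0.
have m2 : m ^+ 2 = x ^+ 2 + y ^+ 2 by rewrite sqr_sqrtr // addr_ge0 // sqr_ge0.
have bound z Z b : `|z - Z| <= K * t ^+ 3 -> `|Z| <= b ->
    `|z ^+ 2 - Z ^+ 2| <= K * (K + 2 * b) * t ^+ 3.
  move=> hz hZ; rewrite (_ : _ - _ = (z - Z) * ((z - Z) + 2 * Z)); last by ring.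
  rewrite normrM mulrAC; apply: ler_pM => //.
  apply: le_trans (ler_normD _ _) _; apply: lerD.
    by apply: le_trans hz _; rewrite ler_piMr.
  by rewrite normrM ger0_norm // ler_wpM2l.
have bD : `|X ^+ 2 + Y ^+ 2 - Q ^+ 2| <= D * t ^+ 3.
  rewrite (_ : _ - _ = ((2 * u * p + 2 * v * q - 2 * u * P)
    + (p ^+ 2 + q ^+ 2 - P ^+ 2) * t) * t ^+ 3); last first.
    by rewrite /X /Y /Q /P; field.
  rewrite normrM [`|t ^+ 3|]ger0_norm // ler_wpM2r //.
  apply: le_trans (ler_normD _ _) _; rewrite lerD2l normrM [`|t|]ger0_norm //.
  by rewrite ler_piMr.
have main : `|m - Q| * (m + Q) <= C * t ^+ 3.
  have mQ0 : 0 <= m + Q by lra.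
  rewrite -[m + Q]ger0_norm // -normrM -subr_sqr m2.
  rewrite (_ : _ - _ = (x ^+ 2 - X ^+ 2) + (y ^+ 2 - Y ^+ 2)
    + (X ^+ 2 + Y ^+ 2 - Q ^+ 2)); last by ring.
  rewrite /C [leRHS]mulrDl [X in _ <= X + _]mulrDl.
  apply: le_trans (ler_normD _ _) _; apply: lerD => //.
  apply: le_trans (ler_normD _ _) _.
  exact: lerD (bound _ _ _ hx XA) (bound _ _ _ hy YB).
have mQ2 : 2^-1 <= m + Q by lra.
rewrite -(mulrA 2 C) -ler_pdivrMl // mulrC; apply: le_trans main.
exact: ler_wpM2l (normr_ge0 _) _ _ mQ2.
Qed.

(** * The Puiseux series along the ray *)

(* Mathcomp's [Num.sqrt] vanishes on negative reals, so [sqrt d + i sqrt (- d)]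
   is a square root of the real number [d] whatever its sign. *)
Definition ray_root (R : realType) (t : R) (s : bool) (d : R) : Cplx R :=
  (-1) ^+ s * (Num.sqrt d +i* Num.sqrt (- d)) * cis (- t).

Lemma sqr_real_root (R : realType) (d : R) :
  (Num.sqrt d +i* Num.sqrt (- d)) ^+ 2 = d%:C :> Cplx R.
Proof.
rewrite expr2; simpc; rewrite -!expr2; case: (leP 0 d) => d0.
  by rewrite sqr_sqrtr // [Num.sqrt (- d)]ler0_sqrtr ?oppr_le0 // expr0n
    subr0 mulr0 mul0r addr0.
rewrite ler0_sqrtr ?(ltW d0) // sqr_sqrtr ?oppr_ge0 ?(ltW d0) //.
by rewrite expr0n sub0r opprK mulr0 mul0r addr0.
Qed.

Lemma sqr_ray_root (R : realType) (t : R) (s : bool) (d : R) :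
  ray_root R t s d ^+ 2 = d%:C * cis (- (2 * t)).
Proof.
rewrite /ray_root !exprMn sqrr_sign mul1r sqr_real_root [cis _ ^+ 2]expr2 -cisD.
by congr (_ * cis _); ring.
Qed.

Lemma normr_ray_root (R : realType) (t : R) (s : bool) (d : R) :
  `|ray_root R t s d| = (Num.sqrt `|d|)%:C.
Proof.
apply/eqP; rewrite -(eqrXn2 (ltn0Sn 1) (normr_ge0 _)) ?lecR ?sqrtr_ge0 //.
rewrite -normrX sqr_ray_root -rmorphXn /= sqr_sqrtr // normrM !norm_cmod.
by rewrite cmod_cis mulr1 cmodE /= expr0n addr0 sqrtr_sqr.
Qed.

(** The rotation [cis (- ta)] in [w] cancels the argument of [a] in [a * w] and turns that of [b]
    into [tb - 2 * ta] in [b * w ^+ 2]. Both signs of [d] are treated at once, with constants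
    independent of [s] and [d]. *)
Lemma puiseux_ray_expansion (R : realType) (c : nat -> Cplx R) (a b : Cplx R)
    (ta tb : R) :
  c 0%N = 1 -> c 1%N = a -> c 2%N = b ->
  a = (cmod a)%:C * cis ta -> b = (cmod b)%:C * cis tb ->
  (\forall s \near (0 : Cplx R), cvgn (cpseries c s)) ->
  exists2 K : R, 0 <= K & exists2 e : R, 0 < e &
  forall (s : bool) (d : R), `|d| < e ->
    let w := ray_root R ta s d in
    `|complex.Re (limn (cpseries c w) : Cplx R)
      - (1 + (-1) ^+ s * cmod a * Num.sqrt d
         + d * cmod b * cos (tb - 2 * ta))| <= K * Num.sqrt `|d| ^+ 3 /\
    `|complex.Im (limn (cpseries c w) : Cplx R)
      - ((-1) ^+ s * cmod a * Num.sqrt (- d)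
         + d * cmod b * sin (tb - 2 * ta))| <= K * Num.sqrt `|d| ^+ 3.
Proof.
move=> c0 c1 c2 hta htb /nbhs_normP[r /= r0 hr].
have [rE r0r] := gtc0_realE R r r0.
pose z0 : Cplx R := (complex.Re r / 2)%:C.
have z0n : `|z0| = (complex.Re r / 2)%:C.
  by rewrite ger0_norm // lecR divr_ge0 // ltW.
have z0_neq0 : z0 != 0 by rewrite -normr_gt0 z0n ltcR divr_gt0.
have hz0 : cvgn (cpseries c z0).
  apply: hr; rewrite /ball_ /= sub0r normrN z0n rE ltcR /=.
  by rewrite ltr_pdivrMr //; lra.
have [M M0 hM] := @power_series_remainder R[i] c z0 3 z0_neq0 hz0.
have [M0r ME] : 0 <= complex.Re M /\ M = (complex.Re M)%:C.
  by move: M0; case: (M) => x y; rewrite lecE /= => /andP[/eqP ->].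
(* As [w] has modulus the square root of [|d|], this keeps it below [r / 4], half the modulus of
   [z0], as the remainder bound requires. *)
exists (complex.Re M) => //; exists ((complex.Re r / 4) ^+ 2).
  by rewrite exprn_gt0 // divr_gt0.
move=> s d hd; set w := ray_root R ta s d.
set t := Num.sqrt `|d|.
have wn : `|w| = t%:C by exact: normr_ray_root.
have tr : t < complex.Re r / 4.
  by rewrite -(ltr_pXn2r (ltn0Sn 1)) ?nnegrE ?sqrtr_ge0 ?sqr_sqrtr // divr_ge0 // ltW.
have wr : ball_ Num.norm 0 r w.
  by rewrite /ball_ /= sub0r normrN wn rE ltcR /=; lra.
have w2 : 2 * `|w| <= `|z0|.
  by rewrite wn z0n -(rmorph_nat (real_complex R) 2) -rmorphM lecR /=; lra.
have := hM w _ w2 (hr w wr).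
rewrite norm_cmod wn ME -rmorphXn -rmorphM lecR.
have -> : series (fun k => c k * w ^+ k) 3 =
    (1 + (-1) ^+ s * cmod a * Num.sqrt d
       + d * cmod b * cos (tb - 2 * ta)) +i*
    ((-1) ^+ s * cmod a * Num.sqrt (- d) + d * cmod b * sin (tb - 2 * ta)).
  pose eps : Cplx R := (-1) ^+ s.
  pose sigma : Cplx R := Num.sqrt d +i* Num.sqrt (- d).
  have aw : a * w = eps * (cmod a)%:C * sigma.
    rewrite /w /ray_root -/sigma -/eps [in LHS]hta (_ : _ * _ =
      eps * (cmod a)%:C * sigma * (cis ta * cis (- ta))); last by ring.
    by rewrite -cisD subrr cis0 mulr1.
  have bw : b * w ^+ 2 = (cmod b)%:C * d%:C * cis (tb - 2 * ta).
    by rewrite /w sqr_ray_root [in LHS]htb mulrACA -cisD.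
  rewrite seriesEord /= !big_ord_recr big_ord0 /= add0r c0 c1 c2 expr0 mulr1 expr1.
  rewrite aw bw /eps /sigma /cis; case: (s); rewrite ?expr1 ?expr0; simpc;
  congr (_ +i* _); ring.
case: (limn (cpseries c w)) => x y h; split; apply: le_trans h.
  exact: (normr_Re_le _ ((x - _) +i* (y - _))).
exact: (normr_Im_le _ ((x - _) +i* (y - _))).
Qed.

(** * The two eigenvalues on each half of the ray *)

Theorem theorem3p8 (R : realType) (n : nat) (A : Cplx R -> 'M[Cplx R]_n)
  (U : set (Cplx R)) (rc lc : Cplx R)
  (hUopen : open U) (hUconn : connected U) (hrc : U rc)
  (hA : forall i j z, U z -> analytic_at (fun rho => A rho i j) z)
  (hlc : lc != 0)
  (hmult : mup lc (char_poly (A rc)) = 2%N)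
  (l1 l2 : Cplx R -> Cplx R)
  (hl : coalescing_eigenvalues A rc lc l1 l2)
  (a b : Cplx R) (c : nat -> Cplx R)
  (hc0 : c 0%N = 1) (hc1 : c 1%N = a) (hc2 : c 2%N = b)
  (hpuiseux : puiseux_pair rc lc l1 l2 c)
  (ha : a != 0)
  (ta tb : R)
  (hta : a = (cmod a)%:C * cis ta) (htb : b = (cmod b)%:C * cis tb) :
  let Theta := tb - 2 * ta in
  let ray := fun d : R => rc + d%:C * cis (- (2 * ta)) in
  let neg := within [set d : R | d <= 0] (nbhs (0 : R)) in
  let pos := within [set d : R | 0 <= d] (nbhs (0 : R)) in
  exists mu : bool -> R -> Cplx R,
    (\forall d \near (0 : R),
       perm_eq [:: mu false d; mu true d] [:: l1 (ray d); l2 (ray d)]) /\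
    forall s : bool,
    [/\ (fun d : R => complex.Re (mu s d / lc)) =
          (fun d => 1 - `|d| * cmod b * cos Theta)
          +O_neg (fun d => `|d| `^ (3 / 2))
        /\ (fun d : R => complex.Re (mu s d / lc)) =
          (fun d => 1 + (-1) ^+ s * cmod a * Num.sqrt d + d * cmod b * cos Theta)
          +O_pos (fun d => d `^ (3 / 2))
      , (fun d : R => complex.Im (mu s d / lc)) =
          (fun d => (-1) ^+ s * cmod a * Num.sqrt `|d|
                    - `|d| * cmod b * sin Theta)
          +O_neg (fun d => `|d| `^ (3 / 2))
        /\ (fun d : R => complex.Im (mu s d / lc)) =
          (fun d => d * cmod b * sin Theta)
          +O_pos (fun d => d `^ (3 / 2))
      & (fun d : R => cmod (mu s d / lc)) =
          (fun d => 1 + `|d| * (1 / 2 * (cmod a ^+ 2 - 2 * cmod b * cos Theta)))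
          +O_neg (fun d => `|d| `^ (3 / 2))
        /\ (fun d : R => cmod (mu s d / lc)) =
          (fun d => 1 + (-1) ^+ s * cmod a * Num.sqrt d + d * cmod b * cos Theta)
          +O_pos (fun d => d `^ (3 / 2))].
Proof.
move=> Theta ray neg pos.
pose w := ray_root R ta.
(* The labels of [l1] and [l2] may swap arbitrarily from one [d] to another, so the signed branches
   are read off the series; [s = false] is the upper sign. *)
pose mu s d : Cplx R := lc * limn (cpseries c (w s d)).
have hcvg : \forall s \near (0 : Cplx R), cvgn (cpseries c s).
  by apply: filterS hpuiseux => s [].
have [K K0 [e e0 hK]] := puiseux_ray_expansion R c a b ta tb hc0 hc1 hc2 hta htb hcvg.
have muE s d : mu s d / lc = limn (cpseries c (w s d)).
  by rewrite /mu mulrC mulKf.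
exists mu; split.
  have /nbhs_normP[r /= r0 hr] := hpuiseux.
  have [rE r0r] := gtc0_realE R r r0.
  apply/nbhs_normP; exists ((complex.Re r) ^+ 2); first by rewrite /= exprn_gt0.
  move=> d; rewrite /ball_ /= sub0r normrN => hd.
  have wr : ball_ Num.norm 0 r (w false d).
    rewrite /ball_ /= sub0r normrN normr_ray_root rE ltcR.
    by rewrite -(ltr_pXn2r (ltn0Sn 1)) ?nnegrE ?sqrtr_ge0 ?sqr_sqrtr // ltW.
  have [_ _] := hr _ wr.
  rewrite sqr_ray_root perm_sym => hperm.
  (* The two roots are opposite, so [mu] lists the values of the series at [w false d] and at its
     negative. *)
  rewrite /mu (_ : w true d = - w false d) //.
  by rewrite /w /ray_root expr1 expr0 !mulN1r mul1r mulNr.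
move=> s.
have hRe (d : R) (hd : `|d| < e) := (hK s d hd).1.
have hIm (d : R) (hd : `|d| < e) := (hK s d hd).2.
have pow (d : R) : `| `|d| `^ (3 / 2) | = Num.sqrt `|d| ^+ 3.
  by rewrite ger0_norm ?powR_ge0 // powR_3div2.
have powp (d : R) : 0 <= d -> `| d `^ (3 / 2) | = Num.sqrt `|d| ^+ 3.
  by move=> d0; rewrite -pow (ger0_norm d0).
(* On each half-line one of [Num.sqrt d] and [Num.sqrt (- d)] takes its default value 0, which
   leaves the half-order term in only one of the two parts. *)
have negE (d : R) : d <= 0 -> [/\ d = - `|d|, Num.sqrt d = 0 & - d = `|d| ].
  by move=> d0; rewrite ler0_norm // opprK ler0_sqrtr.
have posE (d : R) : 0 <= d -> Num.sqrt (- d) = 0.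
  by move=> d0; rewrite ler0_sqrtr // oppr_le0.
have hReN (d : R) : d <= 0 -> `|d| < e -> `|complex.Re (mu s d / lc)
    - (1 - `|d| * cmod b * cos Theta)| <= K * Num.sqrt `|d| ^+ 3.
  move=> dle hd; rewrite muE; move: (hRe d hd).
  by have [dE -> _] := negE d dle; rewrite mulr0 addr0 {2}dE !mulNr.
have hReP (d : R) : 0 <= d -> `|d| < e -> `|complex.Re (mu s d / lc)
    - (1 + (-1) ^+ s * cmod a * Num.sqrt d + d * cmod b * cos Theta)|
    <= K * Num.sqrt `|d| ^+ 3.
  by move=> dge hd; rewrite muE; exact: hRe.
have hImN (d : R) : d <= 0 -> `|d| < e -> `|complex.Im (mu s d / lc)
    - ((-1) ^+ s * cmod a * Num.sqrt `|d| - `|d| * cmod b * sin Theta)|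
    <= K * Num.sqrt `|d| ^+ 3.
  move=> dle hd; rewrite muE; move: (hIm d hd).
  by have [dE _ ->] := negE d dle; rewrite {3}dE !mulNr.
have hImP (d : R) : 0 <= d -> `|d| < e -> `|complex.Im (mu s d / lc)
    - d * cmod b * sin Theta| <= K * Num.sqrt `|d| ^+ 3.
  move=> dge hd; rewrite muE; move: (hIm d hd).
  by rewrite (posE d dge) mulr0 add0r.
have sqrt_lt (d x : R) : 0 < x -> `|d| < x ^+ 2 -> Num.sqrt `|d| < x.
  move=> x0 dx; rewrite -(ltr_pXn2r (ltn0Sn 1)) ?nnegrE ?sqrtr_ge0 ?(ltW x0) //.
  by rewrite sqr_sqrtr.
split; split.
- apply: (@bigO_within0 R _ _ _ _ K e e0) => d /= d0 hd.
  by rewrite pow; exact: hReN.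
- apply: (@bigO_within0 R _ _ _ _ K e e0) => d /= d0 hd.
  by rewrite powp //; exact: hReP.
- apply: (@bigO_within0 R _ _ _ _ K e e0) => d /= d0 hd.
  by rewrite pow; exact: hImN.
- apply: (@bigO_within0 R _ _ _ _ K e e0) => d /= d0 hd.
  by rewrite powp //; exact: hImP.
(* For [d <= 0] the half-order term is imaginary: it enters the modulus only through its square,
   which loses the sign and yields the [cmod a ^+ 2 / 2] contribution. *)
- have [C [e' [e'0 hC]]] := modulus_expansion R 0 ((-1) ^+ s * cmod a)
    (- (cmod b * cos Theta)) (- (cmod b * sin Theta)) K K0.
  apply: (@bigO_within0 R _ _ _ _ C (Num.min e (e' ^+ 2))).
    by rewrite lt_min e0 exprn_gt0.
  move=> d /= d0; rewrite lt_min => /andP[hd hd'].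
  have := hC _ (complex.Re (mu s d / lc)) (complex.Im (mu s d / lc))
    (sqrtr_ge0 _) (sqrt_lt d e' e'0 hd').
  rewrite sqr_sqrtr // -cmodE pow => {}hC.
  rewrite (_ : 1 + _ = 1 + 0 * Num.sqrt `|d| + (- (cmod b * cos Theta)
    + ((-1) ^+ s * cmod a) ^+ 2 / 2) * `|d|); last first.
    by rewrite exprMn sqrr_sign; field.
  apply: hC.
    rewrite (_ : 1 + _ + _ = 1 - `|d| * cmod b * cos Theta); last by ring.
    exact: hReN.
  rewrite (_ : _ * Num.sqrt _ + _ = (-1) ^+ s * cmod a * Num.sqrt `|d|
    - `|d| * cmod b * sin Theta); last by congr (_ + _); ring.
  exact: hImN.
(* For [d >= 0] that term is real and [v = 0], so the modulus has the expansion of the real part. *)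
- have [C [e' [e'0 hC]]] := modulus_expansion R ((-1) ^+ s * cmod a) 0
    (cmod b * cos Theta) (cmod b * sin Theta) K K0.
  apply: (@bigO_within0 R _ _ _ _ C (Num.min e (e' ^+ 2))).
    by rewrite lt_min e0 exprn_gt0.
  move=> d /= d0; rewrite lt_min => /andP[hd hd'].
  have := hC _ (complex.Re (mu s d / lc)) (complex.Im (mu s d / lc))
    (sqrtr_ge0 _) (sqrt_lt d e' e'0 hd').
  rewrite sqr_sqrtr // -cmodE powp // [0 ^+ 2]expr2 !mul0r addr0 add0r.
  rewrite !(ger0_norm d0) -!(mulrC d) !(mulrA d) => {}hC.
  have := hReP d d0 hd; have := hImP d d0 hd; rewrite (ger0_norm d0).
  by move=> hy hx; exact: hC.
Qed.
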